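(* Let $(M_i)_{i\in\omega}$ be a sequence with $\emptyset\ne M_i\subseteq\omega^{B_i}$, where each $B_i$ is a nonempty finite set, each $M_i$ is an upper set, and $0\notin M_i$ for all $i$. Let $(T_i)_{i\in\omega}$ and $(T'_i)_{i\in\omega}$ be the uniform and geometric thresholds of $(M_i)_{i\in\omega}$, respectively. If both $\#B_i\to\infty$ and $T'_i\to\infty$ as $i\to\infty$, then $T_i/T'_i\to1$ as $i\to\infty$.
   Context: $\omega$ denotes the set of nonnegative integers and $\omega^B$ the set of functions $B\to\omega$, ordered pointwise; $0$ is the zero function. $M$ is an upper set if $f\in M$, $f\le g$ imply $g\in M$. For $T\in\omega$, $\mu_T$ is the probability measure on $\omega^B$ uniform on $\{f:\sum_{b\in B}f(b)=T\}$ and zero elsewhere. The geometric distribution on $\omega$ with parameter $0<p\le1$ assigns probability $p(1-p)^k$ to $k$. For $T\in\mathbb{R}_{\ge0}$, $\nu_T$ is the product of $\#B$ copies of the geometric distribution with parameter $(1+T/\#B)^{-1}$. The uniform threshold of $(M_i)$ is the sequence $(T_i)$ where $T_i\in\omega$ is minimal with $\mu_{T_i}(M_i)\ge\tfrac12$; the geometric threshold is the sequence $(T'_i)$ where $T'_i$ is the unique positive real with $\nu_{T'_i}(M_i)=\tfrac12$. *)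

(* Defs.v *)
From Stdlib Require Import Reals Lra Lia List ClassicalEpsilon.
Import ListNotations.
Open Scope R_scope.

(* A finite set B with #B = n is identified with {0,...,n-1}; an element of
   omega^B is then a list of naturals of length n. *)

Definition fle (f g : list nat) : Prop := Forall2 le f g.

Definition fzero (n : nat) : list nat := repeat 0%nat n.

Definition upper_set (n : nat) (M : list nat -> Prop) : Prop :=
  forall f g, length f = n -> length g = n -> M f -> fle f g -> M g.

Fixpoint comps (n T : nat) : list (list nat) :=
  match n with
  | O => match T with O => [ [] ] | S _ => [] end
  | S k => flat_map (fun a => map (cons a) (comps k (T - a))) (seq 0 (S T))
  end.

Definition ind (P : Prop) : R :=
  if excluded_middle_informative P then 1 else 0.

Definition sumR (l : list R) : R := fold_right Rplus 0 l.

Definition mu (n : nat) (T : nat) (M : list nat -> Prop) : R :=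
  sumR (map (fun f => ind (M f)) (comps n T)) / INR (length (comps n T)).

Definition gparam (n : nat) (T : R) : R := / (1 + T / INR n).

Definition gweight (n : nat) (T : R) (f : list nat) : R :=
  fold_right (fun x acc => gparam n T * (1 - gparam n T) ^ x * acc) 1 f.

(* nu_T(M) = l : the countable sum over all f in M, grouped by the total sum k. *)
Definition nu_is (n : nat) (T : R) (M : list nat -> Prop) (l : R) : Prop :=
  infinite_sum
    (fun k => sumR (map (fun f => ind (M f) * gweight n T f) (comps n k))) l.

(* Main.v *)
(** Under [nu_T] the total [K] has mean [T] and variance [T + T^2/n], so by
    Chebyshev it concentrates around [T] as [n] and [T] tend to infinity; and
    conditionally on [K = k] the law is [mu_k].  Together with the monotonicity
    of [mu_k M] in [k] this would give the theorem if [nu_T M] moved away from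
    1/2 by a uniform amount when [T] is multiplied by [1 + eta].  It does:
    for an upper set, scaling [T] by [lam >= 1] multiplies the odds
    [nu_T M / (1 - nu_T M)] by at least [lam].

    Both the monotonicity and the odds inequality are proved by splitting [M]
    according to whether the first coordinate vanishes: the slice [f 0 = 0] lives
    in one dimension less, and removing one unit from the first coordinate of
    the rest gives an upper set [shift M] containing [M]. *)

From Stdlib Require Import Reals List Lra Lia ClassicalEpsilon.
From Coquelicot Require Import Coquelicot.
Require Import Defs.
Import ListNotations.
Open Scope R_scope.

(** Numerator of [mu n k M], with [count n k] as denominator. They are kept apart so that
    inequalities need no division; [count 0 (S k)] is zero. *)
Definition level (n k : nat) (M : list nat -> Prop) : R :=
  sumR (map (fun f => ind (M f)) (comps n k)).

Definition count (n k : nat) : R := INR (length (comps n k)).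

Definition shift (M : list nat -> Prop) (f : list nat) : Prop :=
  match f with [] => False | a :: g => M (S a :: g) end.

(** Lifts a set by one dimension, so that a slice can be compared with a shift. *)
Definition cylinder (M : list nat -> Prop) (f : list nat) : Prop := M (tl f).

(** All [f] of total [k] have the same weight [(1 - q) ^ n * q ^ k], so the product measure is a
    power series in [q], the complement of the geometric parameter. *)
Definition geom_measure (n : nat) (q : R) (M : list nat -> Prop) : R :=
  (1 - q) ^ n * Series (fun k => level n k M * q ^ k).

(** * Counting compositions *)

Lemma ind_bounds (P : Prop) : 0 <= ind P <= 1.
Proof. unfold ind; destruct excluded_middle_informative; lra. Qed.

Lemma ind_le (P Q : Prop) : (P -> Q) -> ind P <= ind Q.
Proof.
  intros H; unfold ind.
  destruct (excluded_middle_informative P), (excluded_middle_informative Q);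
    try lra; tauto.
Qed.

Lemma sumR_app (l l' : list R) : sumR (l ++ l') = sumR l + sumR l'.
Proof. induction l as [|x l IH]; simpl; [|rewrite IH]; lra. Qed.

Lemma sumR_map_ext {A : Type} (u v : A -> R) (l : list A) :
  (forall x, In x l -> u x = v x) -> sumR (map u l) = sumR (map v l).
Proof. intros H; f_equal; now apply map_ext_in. Qed.

Lemma sumR_map_le {A : Type} (u v : A -> R) (l : list A) :
  (forall x, In x l -> u x <= v x) -> sumR (map u l) <= sumR (map v l).
Proof.
  induction l as [|x l IH]; simpl; intros H; [lra|].
  apply Rplus_le_compat; [apply H; now left|apply IH; intros; apply H; now right].
Qed.

Lemma sumR_map_const {A : Type} (c : R) (l : list A) :
  sumR (map (fun _ => c) l) = c * INR (length l).
Proof.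
  induction l as [|x l IH]; [simpl; lra|].
  change (length (x :: l)) with (S (length l)).
  rewrite S_INR. simpl. rewrite IH. lra.
Qed.

Lemma sumR_map_scal {A : Type} (c : R) (u : A -> R) (l : list A) :
  sumR (map (fun x => u x * c) l) = sumR (map u l) * c.
Proof. induction l as [|x l IH]; simpl; [lra|rewrite IH; lra]. Qed.

Lemma in_comps (n k : nat) (f : list nat) :
  In f (comps n k) -> length f = n /\ list_sum f = k.
Proof.
  revert k f; induction n as [|n IH]; intros k f.
  - destruct k; simpl; [|tauto]. intros [<-|[]]. now split.
  - cbn [comps]. rewrite in_flat_map. intros (a & Ha & Hf).
    apply in_seq in Ha. apply in_map_iff in Hf. destruct Hf as (g & <- & Hg).
    destruct (IH _ _ Hg) as [Hl Hs]. simpl. rewrite Hl, Hs. split; lia.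
Qed.

Definition head_succ (f : list nat) : list nat :=
  match f with [] => [] | a :: g => S a :: g end.

(** Pascal's rule for compositions: the first entry is zero, or one unit can be taken from it. *)
Lemma comps_succ_succ (n k : nat) :
  comps (S n) (S k) =
  map (cons 0%nat) (comps n (S k)) ++ map head_succ (comps (S n) k).
Proof.
  cbn [comps].
  change (seq 0 (S (S k))) with (0%nat :: seq 1 (S k)).
  rewrite <- seq_shift. cbn [flat_map]. f_equal.
  generalize (seq 0 (S k)); intros l.
  induction l as [|a l IH]; [reflexivity|].
  cbn [map flat_map]. rewrite IH, map_app. f_equal.
  rewrite map_map. reflexivity.
Qed.

Lemma level_succ_0 (n : nat) (M : list nat -> Prop) :
  level (S n) 0 M = level n 0 (fun f => M (0%nat :: f)).
Proof. unfold level; cbn. now rewrite app_nil_r, map_map. Qed.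

Lemma level_succ_succ (n k : nat) (M : list nat -> Prop) :
  level (S n) (S k) M =
  level n (S k) (fun f => M (0%nat :: f)) + level (S n) k (shift M).
Proof.
  unfold level. rewrite comps_succ_succ, map_app, sumR_app, !map_map.
  f_equal. apply sumR_map_ext. intros f Hf.
  apply in_comps in Hf. destruct f as [|a f]; [easy|reflexivity].
Qed.

Lemma level_mono (n k : nat) (M M' : list nat -> Prop) :
  (forall f, length f = n -> M f -> M' f) -> level n k M <= level n k M'.
Proof.
  intros H. apply sumR_map_le. intros f Hf. apply ind_le.
  apply H. now apply in_comps in Hf.
Qed.

Lemma level_bounds (n k : nat) (M : list nat -> Prop) :
  0 <= level n k M <= count n k.
Proof.
  split.
  - rewrite <- (Rmult_0_l (count n k)). unfold count.
    rewrite <- sumR_map_const. apply sumR_map_le; intros; apply ind_bounds.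
  - rewrite <- (Rmult_1_l (count n k)). unfold count.
    rewrite <- sumR_map_const. apply sumR_map_le; intros; apply ind_bounds.
Qed.

Lemma level_True (n k : nat) : level n k (fun _ => True) = count n k.
Proof.
  rewrite <- (Rmult_1_l (count n k)). unfold count.
  rewrite <- sumR_map_const. apply sumR_map_ext; intros.
  unfold ind; destruct excluded_middle_informative; tauto.
Qed.

Lemma count_succ_0 (n : nat) : count (S n) 0 = count n 0.
Proof. now rewrite <- !level_True, level_succ_0. Qed.

Lemma count_succ_succ (n k : nat) :
  count (S n) (S k) = count n (S k) + count (S n) k.
Proof.
  unfold count. now rewrite comps_succ_succ, length_app, !length_map, plus_INR.
Qed.

Lemma count_0 (n : nat) : count n 0 = 1.
Proof. induction n; [reflexivity|now rewrite count_succ_0]. Qed.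

Lemma count_pos (n k : nat) : 0 < count (S n) k.
Proof.
  induction k as [|k IH]; [rewrite count_0; lra|].
  rewrite count_succ_succ. pose proof (pos_INR (length (comps n (S k)))).
  unfold count in *; lra.
Qed.

(** Since [count n k] is the binomial coefficient of [n + k - 1] over [k], this is the absorption
    identity; Pascal's rule proves it without the closed form. *)
Lemma count_absorption (n k : nat) :
  INR (S k) * count n (S k) = INR n * count (S n) k.
Proof.
  revert k; induction n as [|n IHn]; intros k; [unfold count; simpl; lra|].
  induction k as [|k IHk].
  - pose proof (IHn 0%nat) as H. rewrite count_0 in H.
    rewrite count_succ_succ, !count_0, (S_INR n). simpl INR in *. lra.
  - rewrite (count_succ_succ (S n) k), count_succ_succ.
    pose proof (IHn (S k)) as H. rewrite !S_INR in *. lra.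
Qed.

Lemma count_next (n k : nat) :
  INR (S k) * count n (S k) = (INR n + INR k) * count n k.
Proof.
  rewrite count_absorption. destruct k as [|k].
  - rewrite !count_0; simpl; lra.
  - rewrite count_succ_succ. pose proof (count_absorption n k). lra.
Qed.

(** * Monotonicity of the proportion of an upper set among the levels *)

Lemma upper_set_slice (n : nat) (M : list nat -> Prop) :
  upper_set (S n) M -> upper_set n (fun f => M (0%nat :: f)).
Proof.
  intros H f g Hf Hg HM Hle. apply (H (0%nat :: f)); simpl; auto.
  constructor; auto.
Qed.

Lemma upper_set_shift (n : nat) (M : list nat -> Prop) :
  upper_set (S n) M -> upper_set (S n) (shift M).
Proof.
  intros H [|a f] [|b g] Hf Hg HM Hle; try easy.
  simpl in *. apply (H (S a :: f)); auto.
  inversion Hle; subst. constructor; auto. lia.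
Qed.

Lemma fle_refl (f : list nat) : fle f f.
Proof. induction f; constructor; auto. Qed.

Lemma upper_set_sub_shift (n : nat) (M : list nat -> Prop) (f : list nat) :
  upper_set (S n) M -> length f = S n -> M f -> shift M f.
Proof.
  intros H Hf HM. destruct f as [|a f]; [easy|]. simpl.
  apply (H (a :: f)); auto. constructor; [lia|apply fle_refl].
Qed.

(** By [count_next], this says that [level / count] does not decrease with [k]. The induction
    hypotheses for the slice (smaller [n]) and the shift (smaller [k]) together fall short by one
    copy of the level of [M]; the inclusion of [M] in [shift M] supplies it. *)
Lemma level_next (n k : nat) (M : list nat -> Prop) :
  upper_set n M ->
  (INR n + INR k) * level n k M <= INR (S k) * level n (S k) M.
Proof.
  revert k M; induction n as [|n IHn]; intros k M HM.
  - destruct k as [|k]; unfold level; cbn [comps map sumR fold_right];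
      simpl INR; lra.
  - revert M HM; induction k as [|k IHk]; intros M HM;
      pose proof (upper_set_slice _ _ HM) as HM0;
      pose proof (upper_set_shift _ _ HM) as HM1.
    + rewrite level_succ_succ.
      pose proof (IHn 0%nat _ HM0) as H.
      pose proof (level_mono (S n) 0 M (shift M)
                    (fun f => upper_set_sub_shift n M f HM)) as H'.
      pose proof (level_succ_0 n M) as H''.
      rewrite S_INR. simpl INR in *. nra.
    + pose proof (IHn (S k) _ HM0) as H.
      pose proof (IHk _ HM1) as H1.
      pose proof (level_mono (S n) (S k) M (shift M)
                    (fun f => upper_set_sub_shift n M f HM)) as H'.
      pose proof (level_succ_succ n k M) as H''.
      clear IHn IHk. rewrite (level_succ_succ n (S k)).
      rewrite H'' in H' |- *. rewrite !S_INR in *. lra.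
Qed.

Lemma level_half_mono (n t k : nat) (M : list nat -> Prop) :
  upper_set n M -> (t <= k)%nat ->
  count n t / 2 <= level n t M -> count n k / 2 <= level n k M.
Proof.
  intros HM Htk Ht. induction Htk as [|k Htk IH]; [assumption|].
  pose proof (level_next n k M HM). pose proof (count_next n k).
  pose proof (pos_INR n). pose proof (pos_INR k).
  apply Rmult_le_reg_l with (INR (S k)); [apply lt_0_INR; lia|].
  assert (0 <= (INR n + INR k) * (level n k M - count n k / 2))
    by (apply Rmult_le_pos; lra).
  lra.
Qed.

(** * Products of geometric distributions *)

Lemma count_succ_sum (n k : nat) :
  count (S n) k = sum_f_R0 (count n) k.
Proof.
  induction k as [|k IH]; [apply count_succ_0|].
  rewrite count_succ_succ, IH. simpl. lra.
Qed.

(** Negative binomial series. As [count (S n)] is the sequence of partial sums of [count n], each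
    dimension contributes a Cauchy product with the geometric series. *)
Lemma is_series_count (n : nat) (q : R) :
  0 <= q < 1 -> is_series (fun k => count n k * q ^ k) (/ (1 - q) ^ n).
Proof.
  intros Hq. induction n as [|n IH].
  - apply is_series_decr_1.
    apply is_series_ext with (fun _ => 0).
    + intros k. unfold count; simpl; lra.
    + replace (plus _ _) with 0 by (unfold count, plus, opp; simpl; field).
      apply is_series_Reals. intros e He. exists 0%nat. intros N _.
      unfold Rdist. rewrite sum_cte. rewrite Rmult_0_l, Rminus_0_r, Rabs_R0.
      exact He.
  - replace (/ (1 - q) ^ S n) with (/ (1 - q) ^ n * / (1 - q))
      by (simpl; rewrite Rinv_mult; apply Rmult_comm).
    assert (Hg : is_series (fun k => q ^ k) (/ (1 - q)))
      by (apply is_series_geom; rewrite Rabs_pos_eq; lra).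
    assert (Hpos : forall k, 0 <= q ^ k) by (intros; apply pow_le; lra).
    eapply is_series_ext; [|apply (is_series_mult _ _ _ _ IH Hg)].
    + intros k. simpl. rewrite count_succ_sum, <- (Rmult_comm (q ^ k)), scal_sum.
      apply sum_eq. intros i Hi.
      replace (q ^ k) with (q ^ i * q ^ (k - i)); [ring|].
      rewrite <- pow_add. f_equal; lia.
    + eapply ex_series_ext; [|exists (/ (1 - q) ^ n); exact IH].
      intros k; simpl. symmetry; apply Rabs_pos_eq.
      apply Rmult_le_pos; auto. apply pos_INR.
    + eapply ex_series_ext; [|exists (/ (1 - q)); exact Hg].
      intros k; simpl. symmetry; apply Rabs_pos_eq; auto.
Qed.

Lemma ex_series_level (n : nat) (q : R) (M : list nat -> Prop) :
  0 <= q < 1 -> ex_series (fun k => level n k M * q ^ k).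
Proof.
  intros Hq.
  apply (@ex_series_le R_AbsRing R_CompleteNormedModule)
    with (fun k => count n k * q ^ k).
  - intros k. change (Rabs (level n k M * q ^ k) <= count n k * q ^ k).
    assert (0 <= q ^ k) by (apply pow_le; lra).
    pose proof (level_bounds n k M).
    rewrite Rabs_pos_eq by (apply Rmult_le_pos; lra).
    apply Rmult_le_compat_r; lra.
  - exists (/ (1 - q) ^ n). now apply is_series_count.
Qed.

Lemma geom_measure_mono (n : nat) (q : R) (M M' : list nat -> Prop) :
  0 <= q < 1 -> (forall f, length f = n -> M f -> M' f) ->
  geom_measure n q M <= geom_measure n q M'.
Proof.
  intros Hq H. apply Rmult_le_compat_l; [apply pow_le; lra|].
  apply Series_le; [|now apply ex_series_level].
  intros k. assert (0 <= q ^ k) by (apply pow_le; lra).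
  pose proof (level_bounds n k M).
  split; [apply Rmult_le_pos; lra|].
  apply Rmult_le_compat_r; [lra|now apply level_mono].
Qed.

Lemma is_series_nonneg (a : nat -> R) (l : R) :
  (forall k, 0 <= a k) -> is_series a l -> 0 <= l.
Proof.
  intros Ha Hl.
  apply (is_lim_seq_le (fun _ => 0) (sum_n a) 0 l);
    [|apply is_lim_seq_const|exact Hl].
  intros N. induction N as [|N IH]; [now rewrite sum_O|].
  rewrite sum_Sn. now apply Rplus_le_le_0_compat.
Qed.

Lemma is_series_lincomb (a b : nat -> R) (la lb x y : R) :
  is_series a la -> is_series b lb ->
  is_series (fun k => x * a k + y * b k) (x * la + y * lb).
Proof.
  intros Ha Hb.
  exact (is_series_plus _ _ _ _ (is_series_scal x _ _ Ha)
           (is_series_scal y _ _ Hb)).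
Qed.

Lemma is_series_level (n : nat) (q : R) (M : list nat -> Prop) :
  0 <= q < 1 ->
  is_series (fun k => level n k M * q ^ k) (geom_measure n q M / (1 - q) ^ n).
Proof.
  intros Hq. unfold geom_measure.
  replace (_ / _) with (Series (fun k => level n k M * q ^ k))
    by (field; apply pow_nonzero; lra).
  now apply Series_correct, ex_series_level.
Qed.

Lemma geom_measure_True (n : nat) (q : R) :
  0 <= q < 1 -> geom_measure n q (fun _ => True) = 1.
Proof.
  intros Hq. unfold geom_measure.
  rewrite (Series_ext _ (fun k => count n k * q ^ k))
    by (intros k; now rewrite level_True).
  rewrite (is_series_unique _ _ (is_series_count n q Hq)).
  apply Rinv_r, pow_nonzero; lra.
Qed.

Lemma geom_measure_bounds (n : nat) (q : R) (M : list nat -> Prop) :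
  0 <= q < 1 -> 0 <= geom_measure n q M <= 1.
Proof.
  intros Hq. split.
  - apply Rmult_le_pos; [apply pow_le; lra|].
    apply (is_series_nonneg (fun k => level n k M * q ^ k));
      [|now apply Series_correct, ex_series_level].
    intros k. apply Rmult_le_pos; [apply level_bounds|apply pow_le; lra].
  - rewrite <- (geom_measure_True n q Hq). now apply geom_measure_mono.
Qed.

Lemma geom_measure_0 (q : R) (M : list nat -> Prop) :
  0 <= q < 1 -> geom_measure 0 q M = ind (M []).
Proof.
  intros Hq. unfold geom_measure.
  rewrite (Series_ext _ (fun k => ind (M []) * (count 0 k * q ^ k))).
  - rewrite Series_scal_l, (is_series_unique _ _ (is_series_count 0 q Hq)).
    simpl. field.
  - intros [|k]; unfold level, count; simpl; ring.
Qed.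

(** The first coordinate vanishes with probability [1 - q]. Otherwise, by memorylessness, removing
    one unit from it restores the original law. *)
Lemma geom_measure_succ (n : nat) (q : R) (M : list nat -> Prop) :
  0 <= q < 1 ->
  geom_measure (S n) q M =
  (1 - q) * geom_measure n q (fun f => M (0%nat :: f)) +
  q * geom_measure (S n) q (shift M).
Proof.
  intros Hq. unfold geom_measure.
  set (M0 := fun f => M (0%nat :: f)).
  assert (E0 := ex_series_level n q M0 Hq).
  assert (E1 := ex_series_level (S n) q (shift M) Hq).
  assert (H : Series (fun k => level (S n) k M * q ^ k) =
              Series (fun k => level n k M0 * q ^ k) +
              q * Series (fun k => level (S n) k (shift M) * q ^ k)).
  { rewrite Series_incr_1 by now apply ex_series_level.
    rewrite (Series_incr_1 (fun k => level n k M0 * q ^ k)) by assumption.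
    rewrite <- Series_scal_l, Rplus_assoc, <- Series_plus.
    - rewrite level_succ_0. f_equal. apply Series_ext. intros k.
      rewrite level_succ_succ. fold M0. simpl. ring.
    - now apply (ex_series_incr_1 (fun k => level n k M0 * q ^ k)).
    - exact (ex_series_scal q _ E1). }
  rewrite H. simpl. ring.
Qed.

(** A cylinder is its own shift on nonempty lists, so [geom_measure_succ] becomes the equation
    [x = (1 - q) * y + q * x]. *)
Lemma geom_measure_cylinder (n : nat) (q : R) (M : list nat -> Prop) :
  0 <= q < 1 -> geom_measure (S n) q (cylinder M) = geom_measure n q M.
Proof.
  intros Hq. pose proof (geom_measure_succ n q (cylinder M) Hq) as H.
  assert (H1 : geom_measure (S n) q (shift (cylinder M)) =
               geom_measure (S n) q (cylinder M)).
  { apply Rle_antisym; apply geom_measure_mono; auto;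
      intros [|a f]; easy. }
  rewrite H1 in H.
  change (fun f => cylinder M (0%nat :: f)) with (fun f => M f) in H.
  change (fun f => M f) with M in H. nra.
Qed.

(** The cylinder over the slice lies in [shift M]. This gives the ordering [a <= s] required by
    [odds_scale_mix]. *)
Lemma geom_measure_slice_le_shift (n : nat) (q : R) (M : list nat -> Prop) :
  0 <= q < 1 -> upper_set (S n) M ->
  geom_measure n q (fun f => M (0%nat :: f)) <= geom_measure (S n) q (shift M).
Proof.
  intros Hq HM. rewrite <- geom_measure_cylinder by assumption.
  apply geom_measure_mono; auto. intros [|a f] Hf H; [easy|].
  apply (HM (0%nat :: f)); auto. constructor; [lia|apply fle_refl].
Qed.

(** * The odds inequality for upper sets *)

(* [odds_scale lam x / (1 - odds_scale lam x) = lam * (x / (1 - x))]. *)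
Definition odds_scale (lam x : R) : R := lam * x / (1 + (lam - 1) * x).

Lemma odds_scale_bounds (lam x : R) :
  1 <= lam -> 0 <= x <= 1 -> 0 <= odds_scale lam x <= 1.
Proof.
  intros Hl Hx. unfold odds_scale.
  assert (0 < 1 + (lam - 1) * x) by nra.
  split.
  - apply Rmult_le_pos; [nra|]. left; now apply Rinv_0_lt_compat.
  - apply Rmult_le_reg_r with (1 + (lam - 1) * x); [lra|].
    unfold Rdiv. rewrite Rmult_assoc, Rinv_l by lra. nra.
Qed.

Lemma odds_scale_lt_1 (lam x : R) :
  1 <= lam -> 0 <= x < 1 -> 0 <= odds_scale lam x < 1.
Proof.
  intros Hl Hx. split; [apply odds_scale_bounds; lra|].
  unfold odds_scale. assert (0 < 1 + (lam - 1) * x) by nra.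
  apply Rmult_lt_reg_r with (1 + (lam - 1) * x); [lra|].
  unfold Rdiv. rewrite Rmult_assoc, Rinv_l by lra. nra.
Qed.

(* After clearing denominators, with [u = 1 + (lam-1) a] and
   [v = 1 + (lam-1) s], this is [q (1-q) (v - u) (lam u - v) >= 0]. *)
Lemma odds_scale_mix (lam q a s : R) :
  1 <= lam -> 0 <= q < 1 -> 0 <= a -> a <= s -> s <= 1 ->
  odds_scale lam ((1 - q) * a + q * s) <=
  (1 - odds_scale lam q) * odds_scale lam a +
  odds_scale lam q * odds_scale lam s.
Proof.
  intros Hl Hq Ha Has Hs. apply Rminus_le_0. unfold odds_scale.
  assert (0 < 1 + (lam - 1) * a) by nra.
  assert (0 < 1 + (lam - 1) * s) by nra.
  assert (0 < 1 + (lam - 1) * q) by nra.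
  assert (0 <= (1 - q) * a + q * s) by nra.
  assert (0 < 1 + (lam - 1) * ((1 - q) * a + q * s)) by nra.
  replace (_ - _) with
    (lam * (q * (1 - q) * (s - a)) *
     ((lam - 1) * ((1 - s) + lam * a)) /
     ((1 + (lam - 1) * a) * (1 + (lam - 1) * s) * (1 + (lam - 1) * q) *
      (1 + (lam - 1) * ((1 - q) * a + q * s)))).
  2: field; repeat split; lra.
  apply Rmult_le_pos.
  - repeat apply Rmult_le_pos; try lra. nra.
  - left; apply Rinv_0_lt_compat; repeat apply Rmult_lt_0_compat; lra.
Qed.

(* The deficit of the claimed inequality for [M] is at most [r] times that of
   [shift M], where [r = odds_scale lam q < 1], hence at most [r ^ j] for
   every [j]. *)
Lemma geom_measure_odds (n : nat) (lam q : R) (M : list nat -> Prop) :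
  1 <= lam -> 0 <= q < 1 -> upper_set n M ->
  odds_scale lam (geom_measure n q M) <= geom_measure n (odds_scale lam q) M.
Proof.
  intros Hl Hq. pose proof (odds_scale_lt_1 lam q Hl Hq) as Hr.
  set (r := odds_scale lam q) in *.
  revert M; induction n as [|n IHn]; intros M HM.
  - rewrite !geom_measure_0 by assumption. right.
    unfold odds_scale, ind; destruct excluded_middle_informative; field; lra.
  (* [shift] stays in dimension [S n], so unfolding the recursion need not terminate; hence the
     induction on the number [j] of unfoldings, for all upper sets [N] at once. *)
  - assert (Hj : forall j N, upper_set (S n) N ->
      odds_scale lam (geom_measure (S n) q N) - r ^ j <= geom_measure (S n) r N).
    { clear M HM. induction j as [|j IHj]; intros N HN.
      - pose proof (geom_measure_bounds (S n) q N Hq) as H.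
        pose proof (odds_scale_bounds lam _ Hl H).
        pose proof (geom_measure_bounds (S n) r N Hr). simpl; lra.
      - rewrite !(geom_measure_succ n _ N) by assumption.
        pose proof (IHn _ (upper_set_slice _ _ HN)) as H0.
        pose proof (IHj _ (upper_set_shift _ _ HN)) as H1.
        pose proof (geom_measure_slice_le_shift n q N Hq HN) as H2.
        pose proof (geom_measure_bounds n q (fun f => N (0%nat :: f)) Hq) as H3.
        pose proof (geom_measure_bounds (S n) q (shift N) Hq) as H4.
        pose proof (odds_scale_mix lam q _ _ Hl Hq (proj1 H3) H2 (proj2 H4)) as H5.
        fold r in H5.
        apply Rmult_le_compat_l with (r := 1 - r) in H0; [|lra].
        apply Rmult_le_compat_l with (r := r) in H1; [|lra].
        simpl. lra. }
    apply Rnot_lt_le; intros Hlt.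
    destruct (pow_lt_1_zero r) with
      (y := odds_scale lam (geom_measure (S n) q M) - geom_measure (S n) r M)
      as [j Hsmall]; [rewrite Rabs_pos_eq; lra|lra|].
    specialize (Hsmall j (le_n j)). specialize (Hj j M HM).
    rewrite Rabs_pos_eq in Hsmall by (apply pow_le; lra). lra.
Qed.

(** * Concentration of the total *)

(** The term at 0 vanishes, and absorption turns the others into [INR n * q] times the counting
    series in dimension [S n]. The second factorial moment repeats this once more. *)
Lemma is_series_first_moment (n : nat) (q : R) :
  0 <= q < 1 ->
  is_series (fun k => INR k * (count n k * q ^ k))
    (INR n * q / (1 - q) ^ S n).
Proof.
  intros Hq. apply is_series_decr_1.
  replace (plus _ _) with (INR n * q * / (1 - q) ^ S n)
    by (unfold plus, opp; simpl; unfold Rdiv; ring).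
  eapply is_series_ext;
    [|exact (is_series_scal (INR n * q) _ _ (is_series_count (S n) q Hq))].
  intros k. change (INR n * q * (count (S n) k * q ^ k) =
    INR (S k) * (count n (S k) * (q * q ^ k))).
  replace (INR (S k) * (count n (S k) * (q * q ^ k)))
    with (INR (S k) * count n (S k) * (q * q ^ k)) by ring.
  rewrite count_absorption. ring.
Qed.

Lemma is_series_second_factorial_moment (n : nat) (q : R) :
  0 <= q < 1 ->
  is_series (fun k => INR k * (INR k - 1) * (count n k * q ^ k))
    (INR n * (INR n + 1) * q ^ 2 / (1 - q) ^ S (S n)).
Proof.
  intros Hq. apply is_series_decr_1.
  replace (plus _ _) with (INR n * q * (INR (S n) * q / (1 - q) ^ S (S n)))
    by (rewrite S_INR; unfold plus, opp; simpl; unfold Rdiv; ring).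
  eapply is_series_ext;
    [|exact (is_series_scal (INR n * q) _ _ (is_series_first_moment (S n) q Hq))].
  intros k. change (INR n * q * (INR k * (count (S n) k * q ^ k)) =
    INR (S k) * (INR (S k) - 1) * (count n (S k) * (q * q ^ k))).
  replace (INR (S k) * (INR (S k) - 1) * (count n (S k) * (q * q ^ k)))
    with (INR (S k) * count n (S k) * (INR (S k) - 1) * (q * q ^ k)) by ring.
  rewrite count_absorption, S_INR. ring.
Qed.

(** The total has mean [n q / (1 - q)] and variance [n q / (1 - q) ^ 2]. *)
Lemma is_series_quadratic (n : nat) (q x y : R) :
  0 <= q < 1 ->
  is_series
    (fun k => (x + y * (INR k - INR n * q / (1 - q)) ^ 2) * (count n k * q ^ k))
    ((x + y * (INR n * q / (1 - q) ^ 2)) / (1 - q) ^ n).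
Proof.
  intros Hq. assert ((1 - q) ^ n <> 0) by (apply pow_nonzero; lra).
  set (c := INR n * q / (1 - q)).
  pose proof (is_series_lincomb _ _ _ _ 1 (1 - 2 * c)
    (* With [c] the mean, [(k - c) ^ 2 = k (k - 1) + (1 - 2 c) k + c ^ 2]. *)
    (is_series_second_factorial_moment n q Hq)
    (is_series_first_moment n q Hq)) as H1.
  pose proof (is_series_lincomb _ _ _ _ y (x + y * c ^ 2)
    H1 (is_series_count n q Hq)) as H2.
  replace (_ / (1 - q) ^ n) with
    (y * (1 * (INR n * (INR n + 1) * q ^ 2 / (1 - q) ^ S (S n)) +
     (1 - 2 * c) * (INR n * q / (1 - q) ^ S n)) +
     (x + y * c ^ 2) * / (1 - q) ^ n).
  - eapply is_series_ext; [|exact H2]. intros k; simpl; ring.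
  - unfold c. simpl. field. split; [lra|assumption].
Qed.

(** Chebyshev's argument: a quadratic in the total that dominates the conditional probability of [M]
    has an expectation that dominates the measure of [M]. *)
Lemma geom_measure_le_quadratic (n : nat) (q x y : R) (M : list nat -> Prop) :
  0 <= q < 1 ->
  (forall k, level n k M <=
             (x + y * (INR k - INR n * q / (1 - q)) ^ 2) * count n k) ->
  geom_measure n q M <= x + y * (INR n * q / (1 - q) ^ 2).
Proof.
  intros Hq H. assert (Hp : 0 < (1 - q) ^ n) by (apply pow_lt; lra).
  pose proof (is_series_lincomb _ _ _ _ 1 (-1)
    (is_series_quadratic n q x y Hq) (is_series_level n q M Hq)) as Hs.
  apply is_series_nonneg in Hs.
  - apply Rmult_le_reg_r with (/ (1 - q) ^ n); [now apply Rinv_0_lt_compat|].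
    unfold Rdiv in *. lra.
  - intros k. assert (0 <= q ^ k) by (apply pow_le; lra).
    specialize (H k). apply Rmult_le_compat_r with (r := q ^ k) in H; lra.
Qed.

Lemma geom_measure_ge_quadratic (n : nat) (q x y : R) (M : list nat -> Prop) :
  0 <= q < 1 ->
  (forall k, (x + y * (INR k - INR n * q / (1 - q)) ^ 2) * count n k <=
             level n k M) ->
  x + y * (INR n * q / (1 - q) ^ 2) <= geom_measure n q M.
Proof.
  intros Hq H. assert (Hp : 0 < (1 - q) ^ n) by (apply pow_lt; lra).
  pose proof (is_series_lincomb _ _ _ _ (-1) 1
    (is_series_quadratic n q x y Hq) (is_series_level n q M Hq)) as Hs.
  apply is_series_nonneg in Hs.
  - apply Rmult_le_reg_r with (/ (1 - q) ^ n); [now apply Rinv_0_lt_compat|].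
    unfold Rdiv in *. lra.
  - intros k. assert (0 <= q ^ k) by (apply pow_le; lra).
    specialize (H k). apply Rmult_le_compat_r with (r := q ^ k) in H; lra.
Qed.

(** * Thresholds *)

Definition gratio (n : nat) (T : R) : R := 1 - gparam n T.

Definition nu (n : nat) (T : R) (M : list nat -> Prop) : R :=
  geom_measure n (gratio n T) M.

Lemma gratio_eq (n : nat) (T : R) :
  (1 <= n)%nat -> 0 < T -> gratio n T = T / (INR n + T).
Proof.
  intros Hn HT. assert (0 < INR n) by (apply lt_0_INR; lia).
  unfold gratio, gparam. field. lra.
Qed.

Lemma gratio_bounds (n : nat) (T : R) :
  (1 <= n)%nat -> 0 < T -> 0 <= gratio n T < 1.
Proof.
  intros Hn HT. assert (0 < INR n) by (apply lt_0_INR; lia).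
  unfold gratio, gparam.
  assert (0 < T / INR n) by now apply Rdiv_lt_0_compat.
  pose proof (Rinv_0_lt_compat (1 + T / INR n)).
  assert (/ (1 + T / INR n) < / 1) by (apply Rinv_lt_contravar; lra).
  rewrite Rinv_1 in *. lra.
Qed.

Lemma gratio_mean (n : nat) (T : R) :
  (1 <= n)%nat -> 0 < T -> INR n * gratio n T / (1 - gratio n T) = T.
Proof.
  intros Hn HT. assert (0 < INR n) by (apply lt_0_INR; lia).
  rewrite gratio_eq by assumption. field. lra.
Qed.

Lemma gratio_variance (n : nat) (T : R) :
  (1 <= n)%nat -> 0 < T ->
  INR n * gratio n T / (1 - gratio n T) ^ 2 = T * (1 + T / INR n).
Proof.
  intros Hn HT. assert (0 < INR n) by (apply lt_0_INR; lia).
  rewrite gratio_eq by assumption. field. lra.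
Qed.

(** The odds of [gratio n T] are [T / n], which is linear in [T]. *)
Lemma odds_scale_gratio (n : nat) (lam T : R) :
  (1 <= n)%nat -> 0 < T -> 1 <= lam ->
  odds_scale lam (gratio n T) = gratio n (lam * T).
Proof.
  intros Hn HT Hl. assert (0 < INR n) by (apply lt_0_INR; lia).
  rewrite !gratio_eq by (assumption || nra).
  unfold odds_scale. field. repeat split; nra.
Qed.

Lemma nu_odds (n : nat) (lam T : R) (M : list nat -> Prop) :
  (1 <= n)%nat -> 0 < T -> 1 <= lam -> upper_set n M ->
  odds_scale lam (nu n T M) <= nu n (lam * T) M.
Proof.
  intros Hn HT Hl HM. unfold nu. rewrite <- odds_scale_gratio by assumption.
  apply geom_measure_odds; auto. now apply gratio_bounds.
Qed.

Lemma gweight_eq (n : nat) (T : R) (f : list nat) :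
  gweight n T f = gparam n T ^ length f * gratio n T ^ list_sum f.
Proof.
  unfold gweight, gratio. induction f as [|a f IH]; simpl; [lra|].
  rewrite IH, pow_add. ring.
Qed.

(** [gweight] is constant on each [comps n k], so it factors out of the inner sum. *)
Lemma nu_is_nu (n : nat) (T l : R) (M : list nat -> Prop) :
  nu_is n T M l -> nu n T M = l.
Proof.
  intros H. apply is_series_Reals, is_series_unique in H.
  rewrite <- H. unfold nu, geom_measure. rewrite <- Series_scal_l.
  apply Series_ext. intros k. unfold level.
  replace (1 - gratio n T) with (gparam n T) by (unfold gratio; ring).
  rewrite (sumR_map_ext (fun f => ind (M f) * gweight n T f)
    (fun f => ind (M f) * (gparam n T ^ n * gratio n T ^ k))).
  - rewrite sumR_map_scal. ring.
  - intros f Hf. apply in_comps in Hf as [Hl Hs].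
    now rewrite gweight_eq, Hl, Hs.
Qed.

(** * Comparison of the two measures by Chebyshev's inequality *)

Lemma mu_lt_half (n t : nat) (M : list nat -> Prop) :
  (1 <= n)%nat -> mu n t M < 1 / 2 -> level n t M <= 1 / 2 * count n t.
Proof.
  destruct n as [|n]; [lia|]. intros _ H.
  pose proof (count_pos n t) as Hc.
  change (level (S n) t M / count (S n) t < 1 / 2) in H.
  apply Rmult_lt_compat_r with (r := count (S n) t) in H; [|assumption].
  unfold Rdiv in H at 1. rewrite Rmult_assoc, Rinv_l in H; lra.
Qed.

Lemma mu_ge_half (n t : nat) (M : list nat -> Prop) :
  (1 <= n)%nat -> mu n t M >= 1 / 2 -> count n t / 2 <= level n t M.
Proof.
  destruct n as [|n]; [lia|]. intros _ H.
  pose proof (count_pos n t) as Hc.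
  change (level (S n) t M / count (S n) t >= 1 / 2) in H.
  apply Rge_le, Rmult_le_compat_r with (r := count (S n) t) in H; [|lra].
  unfold Rdiv in H at 2. rewrite Rmult_assoc, Rinv_l in H; lra.
Qed.

(** The weight majorizes the indicator of a deviation of at least [eta * T]; [chebyshev_bound]
    computes its expectation. *)
Lemma chebyshev_weight (eta T x : R) :
  0 < eta -> 0 < T -> eta * T <= Rabs (x - T) ->
  1 <= / (eta * T) ^ 2 * (x - T) ^ 2.
Proof.
  intros He HT H. assert (0 < eta * T) by now apply Rmult_lt_0_compat.
  apply Rmult_le_reg_l with ((eta * T) ^ 2); [apply pow_lt; lra|].
  rewrite <- Rmult_assoc, Rinv_r by (apply pow_nonzero; lra).
  rewrite <- (pow2_abs (x - T)), Rmult_1_r, Rmult_1_l.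
  apply pow_incr; lra.
Qed.

Lemma chebyshev_bound (n : nat) (eta T : R) :
  (1 <= n)%nat -> 0 < eta -> 0 < T ->
  / (eta * T) ^ 2 * (T * (1 + T / INR n)) = (/ T + / INR n) / eta ^ 2.
Proof.
  intros Hn He HT. assert (0 < INR n) by (apply lt_0_INR; lia).
  field. lra.
Qed.

(** The majorant is 1/2 plus the Chebyshev weight: below [t] the 1/2 suffices, and from [t] on the
    weight alone is at least 1. *)
Lemma nu_le_of_mu_lt_half (n t : nat) (eta T : R) (M : list nat -> Prop) :
  (1 <= n)%nat -> 0 < eta -> 0 < T -> (1 + eta) * T <= INR t ->
  (forall j, (j < t)%nat -> mu n j M < 1 / 2) ->
  nu n T M <= 1 / 2 + (/ T + / INR n) / eta ^ 2.
Proof.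
  intros Hn He HT Ht Hmu.
  rewrite <- chebyshev_bound, <- gratio_variance by assumption.
  apply geom_measure_le_quadratic; [now apply gratio_bounds|].
  rewrite gratio_mean by assumption. intros k.
  pose proof (level_bounds n k M) as Hb.
  assert (Hi : 0 < / (eta * T) ^ 2)
    by (apply Rinv_0_lt_compat, pow_lt; nra).
  pose proof (pow2_ge_0 (INR k - T)).
  destruct (Nat.lt_ge_cases k t) as [Hk|Hk].
  - pose proof (mu_lt_half n k M Hn (Hmu k Hk)).
    assert (0 <= / (eta * T) ^ 2 * (INR k - T) ^ 2) by (apply Rmult_le_pos; lra).
    nra.
  - apply le_INR in Hk.
    assert (1 <= / (eta * T) ^ 2 * (INR k - T) ^ 2).
    { apply chebyshev_weight; auto. rewrite Rabs_pos_eq; nra. }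
    nra.
Qed.

(** The minorant is 1/2 minus the weight: from [t] on, monotonicity of the levels keeps the
    proportion at least 1/2, and below [t] the minorant is negative. *)
Lemma nu_ge_of_mu_ge_half (n t : nat) (eta T : R) (M : list nat -> Prop) :
  (1 <= n)%nat -> 0 < eta -> 0 < T -> upper_set n M ->
  INR t <= (1 - eta) * T -> mu n t M >= 1 / 2 ->
  1 / 2 - (/ T + / INR n) / eta ^ 2 <= nu n T M.
Proof.
  intros Hn He HT HM Ht Hmu.
  rewrite <- chebyshev_bound, <- gratio_variance by assumption.
  unfold Rminus. rewrite Ropp_mult_distr_l.
  apply geom_measure_ge_quadratic; [now apply gratio_bounds|].
  rewrite gratio_mean by assumption. intros k.
  pose proof (level_bounds n k M) as Hb.
  assert (Hi : 0 < / (eta * T) ^ 2)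
    by (apply Rinv_0_lt_compat, pow_lt; nra).
  pose proof (pow2_ge_0 (INR k - T)).
  destruct (Nat.le_gt_cases t k) as [Hk|Hk].
  - pose proof (level_half_mono n t k M HM Hk (mu_ge_half n t M Hn Hmu)).
    assert (0 <= / (eta * T) ^ 2 * (INR k - T) ^ 2) by (apply Rmult_le_pos; lra).
    nra.
  - apply lt_INR in Hk.
    assert (1 <= / (eta * T) ^ 2 * (INR k - T) ^ 2).
    { apply chebyshev_weight; auto. rewrite Rabs_left1; nra. }
    nra.
Qed.

Theorem theorem11
  (n : nat -> nat) (M : nat -> list nat -> Prop)
  (T : nat -> nat) (T' : nat -> R)
  (Hn : forall i, (1 <= n i)%nat)
  (Hne : forall i, exists f, length f = n i /\ M i f)
  (Hup : forall i, upper_set (n i) (M i))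
  (H0 : forall i, ~ M i (fzero (n i)))
  (HT : forall i, mu (n i) (T i) (M i) >= 1/2 /\
                  forall t, (t < T i)%nat -> mu (n i) t (M i) < 1/2)
  (HT' : forall i, 0 < T' i /\ nu_is (n i) (T' i) (M i) (1/2))
  (Hninf : cv_infty (fun i => INR (n i)))
  (HT'inf : cv_infty T') :
  Un_cv (fun i => INR (T i) / T' i) 1.
Proof.
  intros eps Heps.
  set (e := Rmin eps 1).
  assert (He : 0 < e <= 1).
  { unfold e. split; [apply Rmin_glb_lt; lra|apply Rmin_r]. }
  assert (Hee : e <= eps) by apply Rmin_l.
  (* One third gives [(1 + eta) ^ 2 <= 1 + e] and [1 - e <= (1 - eta) / (1 + eta)], used for the
     upper and lower bound respectively. *)
  set (eta := e / 3). assert (Heta : 0 < eta <= 1 / 3) by (unfold eta; lra).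
  (* [nu] moves by at least [delta] away from 1/2 when [T'] is scaled by
     [1 + eta] either way *)
  set (delta := eta / (2 * (2 + eta))).
  assert (Hd : 0 < delta) by (apply Rdiv_lt_0_compat; lra).
  (* If [S > A / 2] and [n > A], then [1 / S + 1 / n < 3 / A], so the Chebyshev error is below
     [delta]. The half leaves room for [S = T' / (1 + eta)]. *)
  set (A := 4 / (delta * eta ^ 2)).
  assert (HA : 0 < A).
  { apply Rdiv_lt_0_compat; [lra|]. apply Rmult_lt_0_compat; [lra|].
    apply pow_lt; lra. }
  destruct (HT'inf A) as [N1 HN1]. destruct (Hninf A) as [N2 HN2].
  exists (Nat.max N1 N2). intros i Hi.
  assert (HTi : A < T' i) by (apply HN1; lia).
  assert (Hni : A < INR (n i)) by (apply HN2; lia).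
  clear HN1 HN2. destruct (HT i) as [Hmu Hmin]. destruct (HT' i) as [Hpos Hnu].
  apply nu_is_nu in Hnu.
  assert (Hsmall : forall S, A / 2 < S ->
            (/ S + / INR (n i)) / eta ^ 2 < delta).
  { intros S HS.
    assert (H1 : / S < / (A / 2)) by (apply Rinv_lt_contravar; nra).
    assert (H2 : / INR (n i) < / A) by (apply Rinv_lt_contravar; nra).
    apply Rlt_le_trans with (4 * / A / eta ^ 2).
    - apply Rmult_lt_compat_r; [apply Rinv_0_lt_compat, pow_lt; lra|].
      replace (/ (A / 2)) with (2 * / A) in H1 by (field; lra).
      assert (0 < / A) by now apply Rinv_0_lt_compat. lra.
    - right. unfold A. field. lra. }
  assert (Hub : INR (T i) < (1 + e) * T' i).
  (* Otherwise, at [(1 + eta) * T'], concentration puts [nu] below [1 / 2 + delta], while the odds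
     inequality puts it at or above that value. *)
  { apply Rnot_le_lt; intros Hge.
    pose proof (nu_odds (n i) (1 + eta) (T' i) (M i) (Hn i) Hpos ltac:(lra) (Hup i))
      as H1.
    assert (HS : T' i <= (1 + eta) * T' i) by nra.
    pose proof (nu_le_of_mu_lt_half (n i) (T i) eta ((1 + eta) * T' i) (M i)
      (Hn i) (proj1 Heta) ltac:(lra)) as H2.
    specialize (H2 ltac:(unfold eta in *; nra) Hmin).
    specialize (Hsmall ((1 + eta) * T' i) ltac:(lra)).
    rewrite Hnu in H1.
    (* Odds 1 become [1 + eta], that is, probability [(1 + eta) / (2 + eta)]. *)
    replace (odds_scale (1 + eta) (1 / 2)) with (1 / 2 + delta) in H1
      by (unfold odds_scale, delta; field; lra).
    lra. }
  assert (Hlb : (1 - e) * T' i < INR (T i)).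
  { apply Rnot_le_lt; intros Hle.
    (* The odds inequality only scales upwards, so it is applied from [S] to [T']. *)
    set (S := T' i / (1 + eta)).
    assert (HST : (1 + eta) * S = T' i) by (unfold S; field; lra).
    assert (HS : 0 < S) by (apply Rdiv_lt_0_compat; lra).
    pose proof (nu_odds (n i) (1 + eta) S (M i) (Hn i) HS ltac:(lra) (Hup i)) as H1.
    rewrite HST, Hnu in H1.
    pose proof (nu_ge_of_mu_ge_half (n i) (T i) eta S (M i) (Hn i)
      (proj1 Heta) HS (Hup i)) as H2.
    specialize (H2 ltac:(unfold eta in *; nra) Hmu).
    specialize (Hsmall S ltac:(nra)).
    assert (H3 : 0 <= nu (n i) S (M i)).
    { apply geom_measure_bounds, gratio_bounds; auto. }
    (* Clearing denominators in [odds_scale (1 + eta) x <= 1 / 2] gives [(2 + eta) * x <= 1], and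
       [1 / (2 + eta)] is [1 / 2 - delta]. *)
    assert (H4 : nu (n i) S (M i) <= 1 / 2 - delta).
    { unfold odds_scale in H1.
      assert (0 < 1 + (1 + eta - 1) * nu (n i) S (M i)) by nra.
      apply Rmult_le_compat_r with
        (r := 1 + (1 + eta - 1) * nu (n i) S (M i)) in H1; [|lra].
      unfold Rdiv in H1 at 1. rewrite Rmult_assoc, Rinv_l in H1 by lra.
      apply Rmult_le_reg_r with (2 + eta); [lra|].
      replace ((1 / 2 - delta) * (2 + eta)) with 1
        by (unfold delta; field; lra).
      lra. }
    lra. }
  unfold Rdist.
  replace (INR (T i) / T' i - 1) with ((INR (T i) - T' i) / T' i) by (field; lra).
  unfold Rdiv. rewrite Rabs_mult, (Rabs_pos_eq (/ T' i))
    by (left; now apply Rinv_0_lt_compat).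
  apply Rmult_lt_reg_r with (T' i); [lra|].
  rewrite Rmult_assoc, Rinv_l, Rmult_1_r by lra.
  apply Rabs_def1; nra.
Qed.
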